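(* Let $\Sigma_{\mathcal{F}}$ be an irreducible subshift of finite type over $\Sigma=\{0,1,\dots,q-1\}$ with positive topological entropy (that is, its Perron root satisfies $\theta>1$), where $\mathcal{F}=\{a_1,\dots,a_s\}$ is a minimal collection of forbidden words whose longest word has length $p\ge 2$. Let $\mu$ be the Parry measure on $\Sigma_{\mathcal{F}}$. Let $w$ be an allowed word of length $n\ge p$ in $\Sigma_{\mathcal{F}}$ which starts with a word $x$ of length $p-1$ and ends with a word $y$ of length $p-1$. Then \[ \mu(C_w)=\frac{\left(1-\sum_{i=1}^s \mathcal{R}_i(\theta)\,(\widetilde{a_i},x)_\theta\right)\left(1-\sum_{j=1}^s \mathcal{C}_j(\theta)\,(y,a_j)_\theta\right)}{\theta^{n}\left(1+r'(\theta)\right)}, \] where $C_w$ is the cylinder based at the word $w$ in $\Sigma_{\mathcal{F}}$.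
   Context: Let $q\ge 2$ and $\Sigma=\{0,1,\dots,q-1\}$. For a finite collection $\mathcal{F}$ of words over $\Sigma$ (each of length at least two), $\Sigma_{\mathcal{F}}\subset\Sigma^{\mathbb{N}}$ is the set of one-sided sequences containing no word of $\mathcal{F}$ as a (contiguous) subword. A word is allowed in $\Sigma_{\mathcal{F}}$ if it appears as a subword of some sequence in $\Sigma_{\mathcal{F}}$. The (non-empty) collection $\mathcal{F}=\{a_1,\dots,a_s\}$ of distinct words is minimal if all proper subwords of the words in $\mathcal{F}$ are allowed. Let $p\ge 2$ be the length of the longest word in $\mathcal{F}$. Adjacency matrix: $A$ is the $(0,1)$ matrix with rows and columns indexed by the allowed words of length $p-1$ (in lexicographic order), whose entry at $(x_1\dots x_{p-1},\,y_1\dots y_{p-1})$ is $1$ if and only if $x_2\dots x_{p-1}=y_1\dots y_{p-2}$ (no condition if $p=2$) and $x_1\dots x_{p-1}y_{p-1}$ is an allowed word of length $p$. $\Sigma_{\mathcal{F}}$ is irreducible if $A$ is irreducible, i.e. for all $i,j$ there is $\ell\ge1$ with $(A^\ell)_{ij}>0$. The Perron root $\theta$ of $A$ is its spectral radius (an eigenvalue of $A$); the topological entropy of $\Sigma_{\mathcal{F}}$ is $\ln\theta$. Parry measure: the cylinder based at an allowed word $w=w_1\dots w_n$ is $C_w=\{x_1x_2\dots\in\Sigma_{\mathcal{F}} \mid x_1=w_1,\dots,x_n=w_n\}$. The Parry measure $\mu$ is the probability measure on the $\sigma$-algebra generated by cylinders determined by $\mu(C_w)=U_{w_1\dots w_{p-1}}V_{w_{n-p+2}\dots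 w_n}/\theta^{\,n-p+1}$ for every allowed word $w=w_1\dots w_n$ with $n\ge p$, where $V$ and $U$ are right and left positive (column) eigenvectors of $A$ for $\theta$ ($AV=\theta V$, $U^TA=\theta U^T$) normalized so that $U^TV=1$. Correlation: for words $x=x_1\dots x_{p_1}$ and $y=y_1\dots y_{p_2}$, the correlation polynomial is $(x,y)_z=\sum_{\ell=0}^{p_1-1}b_\ell z^{p_1-1-\ell}$, where $b_\ell=1$ if $x_{\ell+k}=y_k$ for all $1\le k\le \min(p_1-\ell,p_2)$, and $b_\ell=0$ otherwise; $(x,y)_\theta$ is its value at $z=\theta$. The correlation matrix of $\mathcal{F}$ is $\mathcal{M}(z)=[(a_j,a_i)_z]_{1\le i,j\le s}$ (the $(i,j)$ entry is $(a_j,a_i)_z$); its determinant is a non-zero polynomial. The rational function $r(z)$ is the sum of all entries of $\mathcal{M}(z)^{-1}$; $\mathcal{R}_i(z)$ is the sum of the entries of the $i$th row and $\mathcal{C}_j(z)$ the sum of the entries of the $j$th column of $\mathcal{M}(z)^{-1}$. Values at $\theta$ are understood as limits: $\mathcal{R}_i(\theta)=\lim_{z\to\theta}\mathcal{R}_i(z)$, $\mathcal{C}_j(\theta)=\lim_{z\to\theta}\mathcal{C}_j(z)$, and $r'(\theta)$ is the derivative at $\theta$ of $r$ with any removable singularity removed. $\widetilde{a_i}$ is the word obtained from $a_i$ by removing its first symbol. *)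

(* Defs.v *)
From HB Require Import structures.
From mathcomp Require Import all_boot all_order all_algebra.
From mathcomp Require Import complex.
From mathcomp Require Import all_classical all_reals all_analysis.

Set Implicit Arguments.
Unset Strict Implicit.
Unset Printing Implicit Defensive.

Import Order.TTheory GRing.Theory Num.Theory.
Import numFieldNormedType.Exports.

Local Open Scope classical_set_scope.
Local Open Scope ring_scope.

Definition window (q : nat) (x : nat -> 'I_q) (k n : nat) : seq 'I_q :=
  [seq x i | i <- iota k n].

Definition subshift (q : nat) (F : seq (seq 'I_q)) : set (nat -> 'I_q) :=
  [set x | forall a k, a \in F -> window x k (size a) <> a].

Definition allowed (q : nat) (F : seq (seq 'I_q)) (w : seq 'I_q) : Prop :=
  exists2 x, subshift F x & exists k, window x k (size w) = w.

Definition minimal_collection (q : nat) (F : seq (seq 'I_q)) : Prop :=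
  forall a u, a \in F -> infix u a -> u != a -> allowed F u.

Definition maxlen (q : nat) (F : seq (seq 'I_q)) : nat :=
  (\max_(a <- F) size a)%N.

(* [enum 'I_q] is increasing, so this lists the words in lexicographic order. *)
Fixpoint words (q n : nat) : seq (seq 'I_q) :=
  if n is m.+1 then [seq c :: u | c <- enum 'I_q, u <- words q m]
  else [:: [::]].

Definition states (q : nat) (F : seq (seq 'I_q)) : seq (seq 'I_q) :=
  [seq u <- words q (maxlen F).-1 | `[< allowed F u >]].

Definition state (q : nat) (F : seq (seq 'I_q)) (i : 'I_(size (states F))) :
    seq 'I_q :=
  nth [::] (states F) i.

(* With p = maxlen F, the word [drop (p - 2) y] consists of the last symbol of
   y; for p = 2 the overlap condition reads [::] == [::]. *)
Definition adjacency (R : realType) (q : nat) (F : seq (seq 'I_q)) :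
    'M[R]_(size (states F)) :=
  \matrix_(i, j)
    ((drop 1 (state i) == take (maxlen F - 2) (state j)) &&
     `[< allowed F (state i ++ drop (maxlen F - 2) (state j)) >])%:R.

Definition irreducible_mx (R : realType) (n : nat) (A : 'M[R]_n) : Prop :=
  forall i j, exists2 l : nat, (1 <= l)%N & 0 < (A ^+ l) i j.

Definition spectral_radius (R : realType) (n : nat) (A : 'M[R]_n) : R :=
  sup [set Normc.normc z | z in
        [set z : R[i] | eigenvalue (map_mx (real_complex R) A) z]].

Definition perron_root (R : realType) (q : nat) (F : seq (seq 'I_q)) : R :=
  spectral_radius (adjacency R F).

(* The space of sequences as a type of its own.  The library requires
   measurable spaces to be pointed; x0 only serves as that point. *)
Definition shift_space (q : nat) (F : seq (seq 'I_q)) (x0 : subshift F) : Type :=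
  subshift F.

HB.instance Definition _ (q : nat) (F : seq (seq 'I_q)) (x0 : subshift F) :=
  Choice.on (shift_space x0).
HB.instance Definition _ (q : nat) (F : seq (seq 'I_q)) (x0 : subshift F) :=
  isPointed.Build (shift_space x0) x0.

Definition cylinder (q : nat) (F : seq (seq 'I_q)) (x0 : subshift F)
    (w : seq 'I_q) : set (shift_space x0) :=
  [set x | window (val x) 0 (size w) = w].
Arguments cylinder {q F} x0 w.

Definition cylinders (q : nat) (F : seq (seq 'I_q)) (x0 : subshift F) :
    set (set (shift_space x0)) :=
  [set cylinder x0 w | w in allowed F].
Arguments cylinders {q F} x0.

Definition is_parry_measure (R : realType) (q : nat) (F : seq (seq 'I_q))
    (x0 : subshift F)
    (mu : probability (g_sigma_algebraType (cylinders x0)) R) : Prop :=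
  exists U V : 'cV[R]_(size (states F)),
    [/\ (forall i, 0 < U i 0) /\ (forall i, 0 < V i 0),
        adjacency R F *m V = perron_root R F *: V,
        U^T *m adjacency R F = perron_root R F *: U^T,
        U^T *m V = 1%:M
      & forall (w : seq 'I_q) (i j : 'I_(size (states F))),
          allowed F w -> (maxlen F <= size w)%N ->
          prefix (state i) w -> suffix (state j) w ->
          mu (cylinder x0 w) =
            (U i 0 * V j 0 / perron_root R F ^+ (size w - maxlen F + 1))%:E].

Definition correlation (R : realType) (q : nat) (x y : seq 'I_q) : {poly R} :=
  \sum_(l < size x)
    (take (minn (size x - l) (size y)) (drop l x) ==
     take (minn (size x - l) (size y)) y)%:R *: 'X^((size x).-1 - l).

Definition correlation_mx (R : realType) (q s : nat)
    (a : s.-tuple (seq 'I_q)) (z : R) : 'M[R]_s :=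
  \matrix_(i, j) (correlation R (tnth a j) (tnth a i)).[z].

(* The inverse is taken pointwise in z.  [invmx] returns a junk value at the
   finitely many z where the determinant vanishes; this is harmless below,
   where only limits over punctured neighbourhoods are used. *)
Definition inv_row_sum (R : realType) (q s : nat)
    (a : s.-tuple (seq 'I_q)) (i : 'I_s) (z : R) : R :=
  \sum_j invmx (correlation_mx a z) i j.

Definition inv_col_sum (R : realType) (q s : nat)
    (a : s.-tuple (seq 'I_q)) (j : 'I_s) (z : R) : R :=
  \sum_i invmx (correlation_mx a z) i j.

Definition inv_sum (R : realType) (q s : nat)
    (a : s.-tuple (seq 'I_q)) (z : R) : R :=
  \sum_i \sum_j invmx (correlation_mx a z) i j.

(* For a rational function f, given pointwise off its poles, this is f with
   its removable singularities removed. *)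
Definition regularize (R : realType) (f : R -> R) (z : R) : R :=
  lim (f y @[y --> z^']).

(* Main.v *)
Require Import Defs.
From mathcomp Require Import all_boot all_order all_algebra.
From mathcomp Require Import all_classical all_reals all_analysis.
From mathcomp Require Import zify ring.

Set Implicit Arguments.
Unset Strict Implicit.
Unset Printing Implicit Defensive.

Import Order.TTheory GRing.Theory Num.Theory.
Import numFieldNormedType.Exports.

Local Open Scope classical_set_scope.
Local Open Scope ring_scope.

(** Minimality makes the allowed words exactly the words that contain no
    forbidden word ([avoids_allowed]).  Give a word of length [n] the weight
    [z ^- n.+1], let [W] be the total weight of these words, and let [E_j] be
    the total weight of those which, followed by some letter, end with [a_j].
    Append a word [v] to an arbitrary such word and look at the first time a
    forbidden word is completed; when no forbidden word other than [v] itself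
    occurs in [v], the part of [v] read by then is a suffix of the completed
    word, so that ([weight_expansion])

      [W = (weight of the u such that u ++ v is allowed) + sum_j O(a_j, v) E_j],

    where the polynomial [O(a_j, v)] records the lengths of the suffixes of
    [a_j] that are prefixes of [v].  Three choices of [v] carry the proof.  For
    [v = a_i] the first term vanishes and [O(a_j, a_i)] is the entry [(i, j)] of
    the correlation matrix [M(z)], so that [M(z) E = W 1]: the row sums of the
    inverse of [M(z)] are [R_j = E_j / W] ([inv_row_sum_near]).  Summing over
    the words [v] of one letter gives [r = 1 / W + q - z] ([inv_sum_near]).  For
    an allowed word [x] of length [p - 1] the first term is [z ^+ (p - 1)] times
    the weight [b x] of the words that end with [x], so that
    [1 - sum_j R_j O(a_j, x) = z ^+ (p - 1) b x / W]; here [O(a_j, x)] is the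
    correlation of [a_j] without its first letter with [x].

    Now [b x] is [z ^- (p - 1)] times a column sum of the resolvent of the
    adjacency matrix.  As the Perron root is geometrically simple, the
    resolvent has a simple pole there with residue [V U^T] ([cvg_resolvent]),
    whence [b x] and [W] have the residues [theta ^- (p - 1) |V| U_x] and
    [kappa = theta ^- (p - 1) |V| |U|], where [|.|] is the sum of the entries.
    All quotients by [W] therefore have limits, even where [M(theta)] is
    singular, and [1 + r'(theta) = 1 / kappa].  The same argument for the
    reversed words, whose correlation matrix is the transpose of [M], turns
    row sums into column sums and [U_x] into [V_y].  The product of the two
    limits, divided by [theta ^+ n (1 + r'(theta))], is the Parry measure.

    The limits at [theta] are two-sided, whereas the series above diverge for
    [z] below [theta].  The weights are therefore not defined as series: words
    of length at most [p - 1] represent all words by their last letters, and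
    the weights [b x] are only required to satisfy the linear equation that
    the resolvent solves ([weight], [weight_next]). *)

(** * Subwords *)

Section Subwords.
Variable T : eqType.
Implicit Types u v w : seq T.

Lemma suffix_nested u v w : suffix u w -> suffix v w ->
  (size u <= size v)%N -> suffix u v.
Proof.
move=> uw vw uv; have vs := size_suffix vw.
move: uw vw; rewrite !suffixE => /eqP {2}<- /eqP <-.
by rewrite !drop_drop size_drop subKn // addnC addnBA // subnK.
Qed.

Lemma infix_eq_size u v : infix u v ->
  (size v <= size u)%N -> u = v.
Proof.
case/infixP => [s [t ->]]; rewrite !size_cat => h.
have s0 : size s = 0%N by lia.
have t0 : size t = 0%N by lia.
by rewrite (size0nil s0) (size0nil t0) cats0.
Qed.

End Subwords.

(** * Sums over words of a given length *)

Section Words.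
Variable q : nat.
Implicit Types (u v w : seq 'I_q).

Lemma mem_words n w : (w \in words q n) = (size w == n).
Proof.
elim: n w => [|n IH] [|c w] //=; first by apply/negbTE/negP => /allpairsP [[d v] []].
rewrite eqSS -IH; apply/allpairsP/idP => [[[d v] /= [_ ? [_ ->]]] //|wn].
by exists (c, w); rewrite mem_enum.
Qed.

Lemma words_uniq n : uniq (words q n).
Proof.
elim: n => //= n IH; apply: allpairs_uniq => //; first exact: enum_uniq.
by move=> [c u] [d v] _ _ [-> ->].
Qed.

Variable V : nmodType.
Implicit Type phi : seq 'I_q -> V.

Lemma big_words_cons n phi :
  \sum_(u <- words q n.+1) phi u = \sum_c \sum_(u <- words q n) phi (c :: u).
Proof. by rewrite big_allpairs_dep big_enum. Qed.

Lemma big_words_rcons n phi :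
  \sum_(u <- words q n.+1) phi u = \sum_(u <- words q n) \sum_c phi (rcons u c).
Proof.
elim: n phi => [|n IH] phi; rewrite big_words_cons.
  by rewrite /= big_seq1; apply: eq_bigr => c _; rewrite big_seq1.
under eq_bigr do rewrite IH.
by rewrite big_words_cons.
Qed.

Lemma big_words_eq n w phi : size w = n ->
  (forall u, size u = n -> u != w -> phi u = 0) ->
  \sum_(u <- words q n) phi u = phi w.
Proof.
move=> wn phi0; rewrite (bigD1_seq w) ?mem_words ?wn //=; last exact: words_uniq.
rewrite big_seq_cond big1 ?addr0 // => u /andP[].
by rewrite mem_words => /eqP; exact: phi0.
Qed.

Lemma big_words_rev n phi :
  \sum_(u <- words q n) phi (rev u) = \sum_(u <- words q n) phi u.
Proof.
rewrite -(big_map rev xpredT phi); apply: perm_big; apply: uniq_perm.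
- by rewrite map_inj_uniq ?words_uniq //; exact: can_inj revK.
- exact: words_uniq.
move=> u; rewrite -{1}[u]revK mem_map; last exact: can_inj revK.
by rewrite !mem_words size_rev.
Qed.

End Words.

(** * Words avoiding the forbidden words *)

Definition avoids (q : nat) (F : seq (seq 'I_q)) (u : seq 'I_q) : bool :=
  all (fun f => ~~ infix f u) F.

Section Avoids.
Variables (q : nat) (F : seq (seq 'I_q)).
Implicit Types (u v w : seq 'I_q).

Lemma avoids_infix u v : infix u v -> avoids F v -> avoids F u.
Proof.
move=> uv /allP Fv; apply/allP => f /Fv; apply: contra => fu.
exact: infix_trans fu uv.
Qed.

Lemma avoids_cons c u : avoids F (c :: u) -> avoids F u.
Proof. exact/avoids_infix/infix_cons. Qed.

Lemma avoids_rcons u c : avoids F (rcons u c) -> avoids F u.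
Proof. exact/avoids_infix/infix_rcons. Qed.

Lemma avoids_catl u v : avoids F (u ++ v) -> avoids F u.
Proof. exact/avoids_infix/prefix_infix. Qed.

Lemma avoids_nil : (forall f, f \in F -> (0 < size f)%N) -> avoids F [::].
Proof.
by move=> F0; apply/allP => f /F0; rewrite infixs0 lt0n size_eq0.
Qed.

Lemma avoids_rev u : avoids [seq rev f | f <- F] (rev u) = avoids F u.
Proof. by rewrite /avoids all_map; apply: eq_all => f /=; rewrite infix_rev. Qed.

(** Forbidden words have length at most [m.+1], so that an occurrence in
    [c :: rcons u d] lies within [c :: u] or within [rcons u d]. *)
Lemma avoids_cons_rcons m c u d : (forall f, f \in F -> (size f <= m.+1)%N) ->
  (m <= size u)%N -> avoids F (c :: u) ->
  avoids F (c :: rcons u d) = avoids F (rcons u d).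
Proof.
move=> Fm mu cu; apply/idP/idP => [|ud]; first exact: avoids_cons.
apply/allP => f fF; rewrite infix_consl negb_or (allP ud f fF) andbT.
have := allP cu f fF; apply: contra => /prefixP [t].
rewrite -rcons_cons -cats1 => e; apply/prefixW/prefixP.
exists (take ((size u).+1 - size f) t); have fm := Fm f fF.
have: take (size (c :: u)) ((c :: u) ++ [:: d]) = take (size (c :: u)) (f ++ t).
  by rewrite e.
by rewrite take_size_cat // take_cat /= ltnNge (leq_trans fm).
Qed.

End Avoids.

(** * Overlap polynomials *)

(** The correlation polynomial indexed by the length [t.+1] of the overlap: the
    coefficient of ['X^t] tells whether the suffix of [x] of length [t.+1] is a
    prefix of [y].  In this form it is visibly symmetric under reversal. *)
Definition overlap (R : realType) (q : nat) (x y : seq 'I_q) : {poly R} :=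
  \sum_(t < minn (size x) (size y))
    (drop (size x - t.+1) x == take t.+1 y)%:R *: 'X^t.

Section Overlap.
Variables (R : realType) (q : nat).
Implicit Types (x y : seq 'I_q).

(** The correlation also has a term for each occurrence of [y] inside [x]
    that is not a suffix; these are excluded. *)
Lemma correlation_overlap x y : (infix y x -> y = x) ->
  correlation R x y = overlap R x y.
Proof.
move=> yx; rewrite /correlation (reindex_inj rev_ord_inj) /=.
under eq_bigr => t _.
  have lt := ltn_ord t.
  rewrite subKn // (_ : (size x).-1 - _ = t)%N; last by lia.
over.
rewrite (bigID (fun t : 'I_(size x) => (t < size y)%N)) /= [X in _ + X]big1.
  rewrite addr0 /overlap.
  rewrite (big_ord_widen_cond _ predT
    (fun t : nat => (drop (size x - t.+1) x == take t.+1 y)%:R *: 'X^t)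
    (geq_minl (size x) (size y))) /=.
  apply: eq_big => [t|t ty]; first by rewrite leq_min ltn_ord.
  rewrite (minn_idPl ty) take_oversize //= size_drop; have := ltn_ord t; lia.
move=> t; rewrite -leqNgt => yt; have := ltn_ord t => tx.
rewrite (minn_idPr _) ?(leq_trans yt) // take_size.
case: eqP => [e|_]; last by rewrite scale0r.
have /yx yxE : infix y x.
  by rewrite -e; apply: infix_trans (infix_take _ _) (infix_drop _ _).
by move: yt; rewrite yxE leqNgt tx.
Qed.

Lemma overlap_rev x y : overlap R (rev y) (rev x) = overlap R x y.
Proof.
rewrite /overlap !size_rev minnC; apply: eq_bigr => t _.
rewrite drop_rev take_rev (can_eq revK) subKn ?[RHS]eq_sym 1?eq_sym //.
by have := ltn_ord t; rewrite ltn_min => /andP[].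
Qed.

(** The first letter of [x] only matters for an overlap by all of [x]. *)
Lemma overlap_behead x y : ~~ prefix x y ->
  overlap R (behead x) y = overlap R x y.
Proof.
case: x => // c x; rewrite /overlap /= prefixE => xy.
have dropE t : (t < size x)%N ->
    drop (size (c :: x) - t.+1) (c :: x) = drop (size x - t.+1) x.
  by move=> tx; rewrite /= subSS -[(size x - t)%N]prednK ?subn_gt0 // subnS.
case: (leqP (size y) (size x)) => [yx|xy'].
  rewrite (minn_idPr (leqW yx)); apply: eq_bigr => t _.
  by rewrite dropE // (leq_trans (ltn_ord t)).
rewrite (minn_idPl xy') big_ord_recr /= subnn drop0.
rewrite eq_sym (negbTE xy) scale0r addr0; apply: eq_bigr => t _.
by rewrite -dropE.
Qed.

End Overlap.

(** * First occurrences of forbidden words *)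

Section FirstOccurrence.
Variables (R : realType) (q s : nat) (a : s.-tuple (seq 'I_q)).
Hypothesis a_ne : forall i, (0 < size (tnth a i))%N.
Hypothesis a_anti : forall i j, infix (tnth a i) (tnth a j) -> i = j.

Implicit Types (u v w x : seq 'I_q) (phi : seq 'I_q -> R).
Local Notation av := (avoids a).

(** The transfer operator of the process that extends a word one letter at a
    time, as long as no forbidden word is completed. *)
Definition next phi u : R := \sum_c (av (rcons u c))%:R * phi (rcons u c).

(** Summing over the appended letter, of which at most one contributes, avoids
    naming the last letter of the forbidden word. *)
Definition ends j u : R := \sum_c (suffix (tnth a j) (rcons u c))%:R.

Lemma avoids_infixN j u : infix (tnth a j) u -> av u = false.
Proof.
by move=> ju; apply/negbTE/allPn; exists (tnth a j); rewrite ?mem_tnth ?negbK.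
Qed.

(** Two forbidden words cannot both be suffixes of one word: the shorter one
    would occur in the longer one. *)
Lemma avoids_step w c : av w ->
  (av (rcons w c))%:R + \sum_j (suffix (tnth a j) (rcons w c))%:R = 1 :> R.
Proof.
move=> avw; case: (pickP (fun j => suffix (tnth a j) (rcons w c))) => [j jw|no].
  rewrite (avoids_infixN (suffixW jw)) add0r (bigD1 j) //= jw big1 ?addr0 //.
  move=> i; case iw: (suffix _ _) => // /eqP[].
  case: (leqP (size (tnth a i)) (size (tnth a j))) => [|/ltnW] ij.
    exact/a_anti/suffixW/(suffix_nested iw jw).
  exact/esym/a_anti/suffixW/(suffix_nested jw iw).
rewrite big1 => [|j _]; last by rewrite no.
rewrite addr0 (_ : av _) //; apply/allP => f /tnthP[j ->].
rewrite infix_rconsl no /=; exact: (allP avw _ (mem_tnth _ _)).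
Qed.

(** Reading [v] letter by letter after [u], either no forbidden word is ever
    completed, or there is a first time at which one is.  In terms of indicator
    functions this is the telescoping sum of [avoids_step] over the prefixes. *)
Lemma first_occurrence u v : av u ->
  (av (u ++ v))%:R + \sum_(t < size v) \sum_j
    (av (u ++ take t v) && suffix (tnth a j) (u ++ take t.+1 v))%:R = 1 :> R.
Proof.
move=> avu; elim/last_ind: v => [|v c IH]; first by rewrite cats0 avu big_ord0 addr0.
rewrite size_rcons big_ord_recr /= -rcons_cat.
under eq_bigr => t _ do under eq_bigr => j _ do
  rewrite -cats1 !takel_cat ?ltn_ord ?(ltnW (ltn_ord _)) //.
rewrite -[in X in _ + (_ + X)]cats1.
under [X in _ + (_ + X)]eq_bigr => j _ do
  rewrite take_size_cat // take_oversize ?size_cat ?addn1 //.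
apply: etrans IH; rewrite addrCA addrC; congr (_ + _).
case uv: (av (u ++ v)) => /=; last first.
  rewrite big1 // addr0; case uvc: (av _) => //.
  by rewrite (avoids_rcons uvc) in uv.
rewrite -[in RHS](avoids_step c uv); congr (_ + _).
by apply: eq_bigr => j _; rewrite catA cats1.
Qed.

Lemma iter_next t phi u : av u ->
  iter t next phi u = \sum_(w <- words q t) (av (u ++ w))%:R * phi (u ++ w).
Proof.
elim: t u => [|t IH] u avu; first by rewrite big_seq1 cats0 avu mul1r.
rewrite iterS big_words_cons; apply: eq_bigr => c _.
case uc: (av (rcons u c)); last first.
  rewrite mul0r big1 // => w _; rewrite -cat_rcons.
  case ucw: (av _); last by rewrite mul0r.
  by rewrite (avoids_catl ucw) in uc.
by rewrite mul1r IH //; apply: eq_bigr => w _; rewrite cat_rcons.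
Qed.

Lemma iter_ends t j u : av u ->
  iter t next (ends j) u = \sum_(w <- words q t.+1)
    (av (u ++ take t w) && suffix (tnth a j) (u ++ w))%:R.
Proof.
move=> avu; rewrite iter_next // big_words_rcons big_seq [RHS]big_seq.
apply: eq_bigr => w; rewrite mem_words => /eqP wt.
rewrite /ends mulr_sumr; apply: eq_bigr => c _.
by rewrite -natrM mulnb rcons_cat -cats1 take_size_cat.
Qed.

(** The forbidden word that occurs first is at least as long as the part of [v]
    read so far; hence that part is an overlap, which does not depend on [u]. *)
Lemma first_occurrence_overlap t j u v : av u -> (t < size v)%N ->
  (infix (tnth a j) v -> tnth a j = v) ->
  (av (u ++ take t v) && suffix (tnth a j) (u ++ take t.+1 v))%:R =
  ((t < minn (size (tnth a j)) (size v))%N &&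
   (drop (size (tnth a j) - t.+1) (tnth a j) == take t.+1 v))%:R
  * iter t next (ends j) u :> R.
Proof.
move=> avu tv jv; set aj := tnth a j in jv *.
have st : size (take t.+1 v) = t.+1 by rewrite size_takel.
rewrite leq_min tv andbT iter_ends //.
have suf w : size w = t.+1 -> (t < size aj)%N -> suffix aj (u ++ w) ->
    w = drop (size aj - t.+1) aj.
  move=> wt taj ajw; have : suffix w aj.
    by apply: suffix_nested (suffix_suffix _ _) ajw _; rewrite wt.
  by rewrite suffixE wt => /eqP.
case: (leqP (size aj) t) => taj /=.
  rewrite mul0r; case h: (_ && _) => //; exfalso; move/andP: h => [_ h].
  have /suffixW h' : suffix aj (take t.+1 v).
    by apply: suffix_nested h (suffix_suffix _ _) _; rewrite st ltnW.
  have e := jv (infix_trans h' (infix_take _ _)).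
  by move: taj; rewrite e leqNgt tv.
case: eqP => e; last first.
  rewrite mul0r; case h: (_ && _) => //; move/andP: h => [_ h].
  by case: e; rewrite -(suf _ st taj h).
rewrite mul1r (big_words_eq st) => [|w wt wv]; first by rewrite take_takel.
case h: (_ && _) => //; move/andP: h => [_ /(suf _ wt taj)].
by rewrite e => we; rewrite we eqxx in wv.
Qed.

(** The coefficients no longer depend on [u], so that this becomes a linear
    relation once the two sides are summed over [u] with weights. *)
Lemma overlap_expansion u v : av u ->
  (forall j, infix (tnth a j) v -> tnth a j = v) ->
  (av (u ++ v))%:R + \sum_j \sum_(t < minn (size (tnth a j)) (size v))
    (drop (size (tnth a j) - t.+1) (tnth a j) == take t.+1 v)%:R
    * iter t next (ends j) u = 1.
Proof.
move=> avu hv; apply: etrans (first_occurrence v avu); congr (_ + _).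
rewrite exchange_big /=; apply: eq_bigr => j _.
under [RHS]eq_bigr => t _ do
  rewrite (first_occurrence_overlap avu (ltn_ord t) (hv j)) -mulnb natrM -mulrA.
rewrite (big_ord_widen_cond _ predT (fun t : nat =>
    (drop (size (tnth a j) - t.+1) (tnth a j) == take t.+1 v)%:R
    * iter t next (ends j) u)
  (geq_minr (size (tnth a j)) (size v))) /= big_mkcond /=.
by apply: eq_bigr => t _; case: ifP => _; rewrite ?mul1r ?mul0r.
Qed.

(** * A weighted sum over words that solves the linear system *)

Variables (m : nat) (z : R) (b : seq 'I_q -> R).
Hypothesis a_m : forall i, (size (tnth a i) <= m.+1)%N.
Hypothesis z_neq0 : z != 0.
Hypothesis b_flow : forall x, size x = m -> av x ->
  z * b x = z ^- m + \sum_c (av (c :: x))%:R * b (take m (c :: x)).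

(** When [b] is a convergent series in [1/z], [weight phi] is the sum over all
    words [u] avoiding [a] of [z ^- (size u).+1 * phi u], for a [phi] which
    depends on the last [m] letters only: [b x] gathers the words that end
    with [x].  The flow equation is all that is needed of [b], and it makes
    sense for [z] below the radius where the series converges. *)
Definition weight phi : R :=
  \sum_(k < m) z ^- k.+1 * \sum_(u <- words q k) (av u)%:R * phi u
  + \sum_(x <- words q m) (av x)%:R * b x * phi x.

(** Words of length [m.+1] and more are represented by their last [m] letters
    only; the functions that may be summed are those blind to the others. *)
Definition local phi := forall c u, (m <= size u)%N -> av (c :: u) ->
  phi (c :: u) = phi u.

Lemma eq_weight phi psi : (forall u, av u -> phi u = psi u) ->
  weight phi = weight psi.
Proof.
move=> e; congr (_ + _); last first.
  by apply: eq_bigr => u _; case E: (av u); rewrite ?mul0r ?e.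
apply: eq_bigr => k _; congr (_ * _).
by apply: eq_bigr => u _; case E: (av u); rewrite ?mul0r ?e.
Qed.

Lemma weightD phi psi : weight (fun u => phi u + psi u) = weight phi + weight psi.
Proof.
rewrite /weight addrACA -!big_split /=; congr (_ + _); apply: eq_bigr => i _.
  rewrite -mulrDr -big_split; congr (_ * _).
  by apply: eq_bigr => u _; rewrite mulrDr.
by rewrite mulrDr.
Qed.

Lemma weightZ k phi : weight (fun u => k * phi u) = k * weight phi.
Proof.
rewrite /weight mulrDr; congr (_ + _); rewrite mulr_sumr; apply: eq_bigr => i _.
  rewrite mulrCA; congr (_ * _); rewrite mulr_sumr.
  by apply: eq_bigr => u _; rewrite mulrCA.
by rewrite mulrCA.
Qed.

Lemma weight0 : weight (fun=> 0) = 0.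
Proof.
rewrite -[RHS](mul0r (weight (fun=> 0))) -weightZ.
by apply: eq_weight => u _; rewrite mulr0.
Qed.

Lemma weight_sum (I : Type) (r : seq I) (phi : I -> seq 'I_q -> R) :
  weight (fun u => \sum_(i <- r) phi i u) = \sum_(i <- r) weight (phi i).
Proof.
elim: r => [|i r IH].
  rewrite big_nil; apply: etrans weight0.
  by apply: eq_weight => u _; rewrite big_nil.
rewrite big_cons -IH -weightD.
by apply: eq_weight => u _; rewrite big_cons.
Qed.

(** Summation over words one letter longer: those of length at most [m] come
    with their weight multiplied by [z], and those of length [m.+1] are counted
    by their last [m] letters, through the flow equation. *)
Lemma weight_next phi : local phi ->
  z * weight phi = weight (next phi) + phi [::].
Proof.
move=> loc; pose S k := \sum_(u <- words q k) (av u)%:R * phi u.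
have next_sum k (c : seq 'I_q -> R) :
    \sum_(u <- words q k) (av u)%:R * c u * next phi u =
    \sum_(w <- words q k.+1) (av w)%:R * c (take k w) * phi w.
  rewrite big_words_rcons big_seq [RHS]big_seq; apply: eq_bigr => u.
  rewrite mem_words => /eqP uk; rewrite mulr_sumr; apply: eq_bigr => d _.
  rewrite -cats1 take_size_cat // cats1 mulrA; congr (_ * _).
  case ud: (av (rcons u d)); first by rewrite (avoids_rcons ud) mul1r mulr1.
  by rewrite mulr0 mul0r.
have S0 : S 0%N = phi [::].
  rewrite /S big_seq1 avoids_nil ?mul1r // => f /tnthP[j ->]; exact: a_ne.
rewrite /weight next_sum mulrDr.
have -> : \sum_(w <- words q m.+1) (av w)%:R * b (take m w) * phi w =
    z * (\sum_(x <- words q m) (av x)%:R * b x * phi x) - z ^- m * S m.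
  rewrite big_words_cons exchange_big /= /S !mulr_sumr -sumrB.
  rewrite big_seq [RHS]big_seq; apply: eq_bigr => x.
  rewrite mem_words => /eqP xm; case avx: (av x); last first.
    rewrite !(mul0r, mulr0) subr0 big1 // => c _.
    case cx: (av _); last by rewrite !mul0r.
    by rewrite (avoids_cons cx) in avx.
  rewrite !mul1r mulrA -mulrBl b_flow // [z ^- m + _]addrC addrK mulr_suml.
  apply: eq_bigr => c _; case cx: (av _); last by rewrite !mul0r.
  by rewrite loc // xm.
suff -> : \sum_(k < m) z ^- k.+1 * \sum_(u <- words q k) (av u)%:R * next phi u =
    z * (\sum_(k < m) z ^- k.+1 * S k) + z ^- m * S m - phi [::] by ring.
under eq_bigr => k _.
  under eq_bigr => u _ do rewrite -[(av u)%:R]mulr1.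
  rewrite (next_sum k (fun=> 1)).
  under eq_bigr => u _ do rewrite mulr1.
over.
rewrite -S0 mulr_sumr.
under [X in _ = X + _ - _]eq_bigr => k _ do rewrite mulrA exprS invfM mulVKf //.
elim: m => [|k IH]; first by rewrite !big_ord0 expr0 invr1 mul1r add0r subrr.
by rewrite !big_ord_recr /= IH /S; ring.
Qed.

Lemma local_next phi : local phi -> local (next phi).
Proof.
move=> loc c u mu cu; apply: eq_bigr => d _.
rewrite rcons_cons (avoids_cons_rcons _ _ mu cu) => [|f /tnthP[j ->] //].
case ud: (av _); rewrite ?mul0r // loc ?size_rcons ?leqW //.
by rewrite (avoids_cons_rcons _ _ mu cu) // => f /tnthP[j ->].
Qed.

(** The boundary terms of [weight_next] are the values of the iterates at the
    empty word. *)
Lemma weight_iter t phi : local phi ->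
  (forall k, (k < t)%N -> iter k next phi [::] = 0) ->
  weight (iter t next phi) = z ^+ t * weight phi.
Proof.
move=> loc; elim: t => [|t IH] phi0; first by rewrite mul1r.
rewrite exprS -mulrA -IH => [|k kt]; last by apply: phi0; rewrite ltnW.
rewrite weight_next ?phi0 ?addr0 //.
by elim: (t) => //= k; exact: local_next.
Qed.

Lemma local_ends j : local (ends j).
Proof.
move=> c u mu cu; apply: eq_bigr => d _; congr ((nat_of_bool _)%:R).
have ajs : (size (tnth a j) <= size (rcons u d))%N.
  by rewrite size_rcons (leq_trans (a_m j)).
apply/idP/idP => [h|]; last by rewrite rcons_cons -cat1s; exact: suffix_catr.
exact: suffix_nested h (suffix_cons _ _) ajs.
Qed.

Lemma weight_iter_ends t j : (t < size (tnth a j))%N ->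
  weight (iter t next (ends j)) = z ^+ t * weight (ends j).
Proof.
move=> tj; apply: weight_iter; first exact: local_ends.
move=> k kt; rewrite iter_ends; last first.
  by apply: avoids_nil => f /tnthP[i ->]; exact: a_ne.
rewrite big_seq big1 // => w; rewrite mem_words => /eqP wk.
case h: (_ && _) => //; move/andP: h => [_ /size_suffix] /=.
by rewrite wk leqNgt (leq_trans _ tj).
Qed.

(** Completing [a_j] after [t] further letters multiplies the weight by
    [z ^+ t]; the overlap polynomial collects these powers. *)
Lemma weight_expansion v : (forall j, infix (tnth a j) v -> tnth a j = v) ->
  weight (fun u => (av (u ++ v))%:R)
  + \sum_j (overlap R (tnth a j) v).[z] * weight (ends j) = weight (fun=> 1).
Proof.
move=> hv; transitivity (weight (fun u => (av (u ++ v))%:R +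
    \sum_j \sum_(t < minn (size (tnth a j)) (size v))
    (drop (size (tnth a j) - t.+1) (tnth a j) == take t.+1 v)%:R
    * iter t next (ends j) u)); last first.
  by apply: eq_weight => u avu; rewrite overlap_expansion.
rewrite weightD; congr (_ + _); rewrite [RHS]weight_sum; apply: eq_bigr => j _.
rewrite [RHS]weight_sum /overlap horner_sum mulr_suml; apply: eq_bigr => t _.
rewrite weightZ weight_iter_ends; last first.
  by have := ltn_ord t; rewrite ltn_min => /andP[].
by rewrite hornerZ hornerXn mulrA.
Qed.

(** No word avoids the forbidden words after [a_i] has been appended to it. *)
Lemma weight_forbidden i :
  \sum_j (overlap R (tnth a j) (tnth a i)).[z] * weight (ends j) =
  weight (fun=> 1).
Proof.
rewrite -(@weight_expansion (tnth a i)) => [|j /a_anti -> //].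
rewrite [X in X + _](_ : _ = 0) ?add0r //; apply: etrans weight0.
apply: eq_weight => u _.
by rewrite (@avoids_infixN i) // suffix_infix.
Qed.

(** Appending [x] amounts to [m] steps of [next] that lead to a word with suffix
    [x], and no shorter word has this suffix. *)
Lemma weight_allowed x : size x = m -> av x ->
  z ^+ m * b x + \sum_j (overlap R (tnth a j) x).[z] * weight (ends j) =
  weight (fun=> 1).
Proof.
move=> xm avx; rewrite -(@weight_expansion x) => [|j jx]; last first.
  by rewrite (avoids_infixN jx) in avx.
congr (_ + _); pose d w : R := (suffix x w)%:R.
transitivity (weight (iter m next d)); last first.
  apply: eq_weight => u avu; rewrite iter_next // (big_words_eq xm).
    by rewrite /d suffix_suffix mulr1.
  move=> w wm wx; rewrite /d; case h: (suffix _ _); last by rewrite mulr0.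
  by move: h; rewrite suffixE size_cat wm xm addnK drop_size_cat // (negbTE wx).
rewrite weight_iter; first last.
- move=> k km; rewrite iter_next; last first.
    by apply: avoids_nil => f /tnthP[i ->]; exact: a_ne.
  rewrite big_seq big1 // => w; rewrite mem_words => /eqP wk.
  rewrite /d; case h: (suffix _ _); last by rewrite mulr0.
  by have := size_suffix h; rewrite wk xm leqNgt km.
- move=> c u mu cu; rewrite /d; congr ((nat_of_bool _)%:R); apply/idP/idP => h.
    by apply: suffix_nested h (suffix_cons _ _) _; rewrite xm.
  by rewrite -cat1s suffix_catr.
congr (_ * _); rewrite /weight big1 ?add0r => [|k _]; last first.
  rewrite big_seq big1 ?mulr0 // => w; rewrite mem_words => /eqP wk.
  rewrite /d; case h: (suffix _ _); last by rewrite mulr0.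
  by have := size_suffix h; have := ltn_ord k; rewrite wk xm ltnNge => /negbTE ->.
rewrite (big_words_eq xm) => [|w wm wx].
  by rewrite /d suffix_refl avx mul1r mulr1.
rewrite /d suffixE wm xm subnn drop0 (negbTE wx) mulr0 //.
Qed.

(** Each word has [q] one-letter extensions, which either avoid the forbidden
    words or complete one of them. *)
Lemma weight_letters : (forall j, 1 < size (tnth a j))%N ->
  q%:R * weight (fun=> 1) = z * weight (fun=> 1) - 1 + \sum_j weight (ends j).
Proof.
move=> a1; have -> : z * weight (fun=> 1) = weight (next (fun=> 1)) + 1.
  exact: weight_next.
rewrite addrK -weight_sum -weightD -weightZ; apply: eq_weight => u avu.
rewrite /next /ends exchange_big -big_split /= mulr1.
under eq_bigr => c _ do rewrite mulr1 (avoids_step _ avu).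
by rewrite sumr_const card_ord.
Qed.

End FirstOccurrence.

(** * Allowed words of a minimal collection *)

Section Allowed.
Variables (q : nat) (F : seq (seq 'I_q)).
Implicit Types (u v w : seq 'I_q) (X Y : nat -> 'I_q).

Lemma window_cat X k n1 n2 :
  window X k (n1 + n2) = window X k n1 ++ window X (k + n1) n2.
Proof. by rewrite /window iotaD map_cat. Qed.

Lemma eq_window X Y k l n : (forall i, (i < n)%N -> X (k + i)%N = Y (l + i)%N) ->
  window X k n = window Y l n.
Proof.
move=> XY; rewrite /window -[k]addn0 -[l]addn0 !iotaDl -!map_comp.
by apply/eq_in_map => i; rewrite mem_iota => /andP[_ /XY].
Qed.

Lemma size_window X k n : size (window X k n) = n.
Proof. by rewrite size_map size_iota. Qed.

Lemma allowed_avoids w : allowed F w -> avoids F w.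
Proof.
move=> [X XF [k wE]]; apply/allP => f fF; apply/infixP => -[u [v e]].
apply: (XF f (k + size u)%N fF); move: wE; rewrite e !size_cat !window_cat.
move/eqP; rewrite eqseq_cat ?size_window // => /andP[_].
by rewrite eqseq_cat ?size_window // => /andP[/eqP].
Qed.

(** Let [u] be the longest suffix of [w] that is a proper prefix of a forbidden
    word.  It is allowed by minimality, and the tail of a sequence that contains
    it also continues [w]: a forbidden word that starts in [w] before [u] and
    ends after [w] would give a longer suffix of this kind. *)
Lemma avoids_allowed w : minimal_collection F ->
  (exists2 f, f \in F & (0 < size f)%N) -> avoids F w -> allowed F w.
Proof.
move=> Fmin [f0 f0F f0_ne] avw.
pose P i := has (fun f => prefix (drop i w) f && (drop i w != f)) F.
have exP : exists i, P i.
  exists (size w); apply/hasP; exists f0 => //.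
  by rewrite drop_size prefix0s eq_sym -size_eq0 -lt0n.
have [i0 /hasP[g gF /andP[ug uNg]] i0_min] := ex_minnP exP.
have [Y YF [k uE]] := Fmin _ _ gF (prefixW ug) uNg.
have i0w : (i0 <= size w)%N.
  apply: i0_min; apply/hasP; exists f0 => //.
  by rewrite drop_size prefix0s eq_sym -size_eq0 -lt0n.
pose X n := if (n < size w)%N then nth (Y 0%N) w n else Y (k + (n - i0))%N.
have Xw n l : (n + l <= size w)%N -> window X n l = take l (drop n w).
  move=> nl; apply: (@eq_from_nth _ (Y 0%N)).
    rewrite size_window size_takel // size_drop leq_subRL //.
    by rewrite (leq_trans _ nl) ?leq_addr.
  rewrite size_window => i il; rewrite nth_take // nth_drop /window.
  by rewrite (nth_map 0%N) ?size_iota // nth_iota // /X (leq_trans _ nl) ?ltn_add2l.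
have XY n l : (i0 <= n)%N -> window X n l = window Y (k + (n - i0)) l.
  move=> i0n; apply: eq_window => i il; rewrite /X; case: ifP => niw; last first.
    by congr Y; lia.
  have hi : (n + i - i0 < size (drop i0 w))%N by rewrite size_drop; lia.
  transitivity (nth (Y 0%N) (drop i0 w) (n + i - i0)).
    by rewrite nth_drop; congr nth; lia.
  rewrite -uE /window (nth_map 0%N) ?size_iota // nth_iota //.
  by congr Y; lia.
exists X; last by exists 0%N; rewrite Xw // drop0 take_size.
move=> f n fF fE; case: (leqP i0 n) => i0n.
  by apply: (YF f (k + (n - i0))%N fF); rewrite -XY.
case: (leqP (n + size f) (size w)) => nf.
  move/allP: avw => /(_ f fF) /negP; apply; rewrite -fE Xw //.
  by apply: infix_trans (infix_take _ _) (infix_drop _ _).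
have nw : (n <= size w)%N by rewrite (leq_trans _ i0w) // ltnW.
move: i0n; rewrite ltnNge => /negP; apply; apply: i0_min; apply/hasP; exists f => //.
apply/andP; split; last first.
  apply/eqP => /(congr1 size); rewrite size_drop => e.
  by move: nf; rewrite -e subnKC ?ltnn.
apply/prefixP; exists (window X (size w) (size f - (size w - n))).
rewrite -[LHS]fE -{1}(@subnKC (size w - n) (size f)); last by rewrite leq_subLR ltnW.
by rewrite window_cat subnKC // Xw ?subnKC // take_oversize // size_drop.
Qed.

End Allowed.

(** * Limits of rational functions and matrices *)

Section Limits.
Variable R : realType.
Implicit Types (theta z : R).

Lemma cvg_sumr (T I : Type) (G : set_system T) {FG : Filter G} (r : seq I)
    (f : I -> T -> R) (l : I -> R) :
  (forall i, f i x @[x --> G] --> l i) ->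
  \sum_(i <- r) f i x @[x --> G] --> \sum_(i <- r) l i.
Proof.
move=> fl; elim: r => [|i r IH].
  under eq_cvg do rewrite big_nil; rewrite big_nil; exact: cvg_cst.
under eq_cvg do rewrite big_cons; rewrite big_cons; exact: cvgD (fl i) IH.
Qed.

Lemma poly_neq0_nbhs (p : {poly R}) theta : p.[theta] != 0 ->
  \forall z \near theta, p.[z] != 0.
Proof. by move=> p0; exact: (cvgr_neq0 _ (@continuous_horner _ p theta) p0). Qed.

Lemma poly_neq0_near (p : {poly R}) theta : p != 0 ->
  \forall z \near theta^', p.[z] != 0.
Proof.
move=> p0; have [k [r + pE]] := multiplicity_XsubC p theta.
rewrite p0 /= rootE => r0.
have rn : \forall z \near theta^', r.[z] != 0.
  by apply: nbhs_dnbhs; exact: poly_neq0_nbhs.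
near=> z; rewrite pE !hornerE mulf_neq0 ?expf_neq0 //; first by near: z.
by rewrite subr_eq0; near: z; exact: nbhs_dnbhs_neq.
Unshelve. all: by end_near. Qed.

(** The entries of the inverse are quotients of cofactors by the determinant. *)
Lemma cvg_invmx n (A : 'M[{poly R}]_n) theta i j :
  map_mx (horner_eval theta) A \in unitmx ->
  invmx (map_mx (horner_eval z) A) i j @[z --> theta] -->
  invmx (map_mx (horner_eval theta) A) i j.
Proof.
move=> Au; pose f z := (\det A).[z]^-1 * (\adj A i j).[z].
have det_eval z : \det (map_mx (horner_eval z) A) = (\det A).[z].
  exact: (det_map_mx (horner_eval z)).
have unitE z : (map_mx (horner_eval z) A \in unitmx) = ((\det A).[z] != 0).
  by rewrite unitmxE det_eval unitfE.
have fE z : (\det A).[z] != 0 -> f z = invmx (map_mx (horner_eval z) A) i j.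
  by rewrite -unitE /invmx => ->; rewrite det_eval mxE -map_mx_adj [in RHS]mxE.
have d0 : (\det A).[theta] != 0 by rewrite -unitE.
have fc : f z @[z --> theta] --> f theta.
  by apply: cvgM; [apply: cvgV => //|]; exact: continuous_horner.
rewrite -fE //; apply: cvg_trans fc.
apply: near_eq_cvg; near=> z; rewrite -fE //; near: z.
exact: poly_neq0_nbhs.
Unshelve. all: by end_near. Qed.

End Limits.

(** * The correlation matrix *)

Section CorrelationMatrix.
Variables (R : realType) (q s : nat) (a : s.-tuple (seq 'I_q)).
Hypothesis a_ne : forall i, (0 < size (tnth a i))%N.
Hypothesis a_anti : forall i j, infix (tnth a i) (tnth a j) -> i = j.
Implicit Types (theta z : R).

Lemma correlation_mx_overlap z i j :
  correlation_mx a z i j = (overlap R (tnth a j) (tnth a i)).[z].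
Proof. by rewrite mxE correlation_overlap // => /a_anti ->. Qed.

Lemma correlation_mx_eval z : correlation_mx a z =
  map_mx (horner_eval z) (\matrix_(i, j) correlation R (tnth a j) (tnth a i)).
Proof. by apply/matrixP => i j; rewrite !mxE. Qed.

(** Dividing column [j] by [z ^+ (size a_j).-1] turns the entries into
    polynomials in [1/z] which at [1/z = 0] form the identity matrix, since no
    forbidden word is a prefix of another one. *)
Lemma correlation_mx_unit_near theta : theta != 0 ->
  \forall z \near theta^', correlation_mx a z \in unitmx.
Proof.
move=> theta0; pose Q : 'M[{poly R}]_s := \matrix_(i, j)
  \sum_(l < size (tnth a j))
    (take (minn (size (tnth a j) - l) (size (tnth a i))) (drop l (tnth a j)) ==
     take (minn (size (tnth a j) - l) (size (tnth a i))) (tnth a i))%:R *: 'X^l.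
have Q0 : map_mx (horner_eval 0) Q = 1%:M.
  apply/matrixP => i j; rewrite !mxE /horner_eval horner_sum.
  rewrite (bigD1 (Ordinal (a_ne j))) //= big1 ?addr0 => [|l l0]; last first.
    move: l0; rewrite -val_eqE /= hornerZ hornerXn expr0n => /negbTE ->.
    by rewrite mulr0.
  rewrite hornerZ hornerXn expr0 mulr1 subn0 drop0; congr ((nat_of_bool _)%:R).
  apply/eqP/eqP => [|->//]; case: leqP => _; rewrite take_size => e.
    by apply/esym/a_anti; rewrite e infix_take.
  by apply: a_anti; rewrite -e infix_take.
have dQ : \det Q != 0.
  apply/eqP => dQ0; move/(congr1 determinant): Q0.
  by rewrite det_map_mx dQ0 det1 rmorph0 => /esym/eqP; rewrite oner_eq0.
have MQ z : z != 0 -> correlation_mx a z =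
    map_mx (horner_eval z^-1) Q *m
    diag_mx (\row_j z ^+ (size (tnth a j)).-1).
  move=> z0; apply/matrixP => i j; rewrite mul_mx_diag !mxE /horner_eval.
  rewrite !horner_sum mulr_suml; apply: eq_bigr => l _.
  rewrite !hornerZ !hornerXn -mulrA; congr (_ * _).
  have lj : (l <= (size (tnth a j)).-1)%N.
    by rewrite -ltnS prednK // ltn_ord.
  by rewrite expfB_cond ?(negbTE z0) // mulrC exprVn.
have invc : (z^-1 : R) @[z --> theta^'] --> (theta^-1)^'.
  apply: (@continuous_injective_withinNx R R GRing.inv).
    exact: inv_continuous.
  by move=> y; exact: invr_inj.
have dQn : \forall z \near theta^', (\det Q).[z^-1] != 0.
  exact: (invc _ (poly_neq0_near theta^-1 dQ)).
near=> z; have z0 : z != 0.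
  near: z; apply: nbhs_dnbhs; exact: (cvgr_neq0 _ cvg_id theta0).
rewrite MQ // unitmx_mul !unitmxE det_map_mx det_diag !unitfE /horner_eval.
apply/andP; split; first by near: z.
by rewrite prodf_seq_neq0; apply/allP => j _; rewrite mxE expf_neq0.
Unshelve. all: by end_near. Qed.

End CorrelationMatrix.

(** * The resolvent near the Perron root *)

Section Resolvent.
Variables (R : realType) (n : nat) (A : 'M[R]_n) (theta : R) (U V : 'cV[R]_n).
Hypothesis A_ge0 : forall i j, 0 <= A i j.
Hypothesis A_irr : irreducible_mx A.
Hypothesis theta_gt0 : 0 < theta.
Hypothesis V_gt0 : forall i, 0 < V i 0.
Hypothesis AV : A *m V = theta *: V.
Hypothesis UA : U^T *m A = theta *: U^T.
Hypothesis UV : U^T *m V = 1%:M.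

Lemma expmx_ge0 l i j : 0 <= (A ^+ l) i j.
Proof.
elim: l i j => [|l IH] i j; first by rewrite expr0 mxE ler0n.
by rewrite exprS mxE sumr_ge0 // => k _; rewrite mulr_ge0.
Qed.

(** Subtracting from [v] the largest multiple of [V] that leaves a nonnegative
    vector produces a nonnegative eigenvector with a zero entry; irreducibility
    spreads this zero to all entries. *)
Lemma eigenvector_unique (v : 'cV[R]_n) : A *m v = theta *: v ->
  exists c, v = c *: V.
Proof.
move=> Av; case: (pickP (fun _ : 'I_n => true)) => [i0 _|no]; last first.
  by exists 0; apply/matrixP => i; have := no i.
pose i := [arg min_(i < i0) (v i 0 / V i 0)]%O.
have i_min j : v i 0 / V i 0 <= v j 0 / V j 0.
  by rewrite /i; case: arg_minP => // k _; apply.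
pose c := v i 0 / V i 0; pose w := v - c *: V; exists c.
have w_ge0 j : 0 <= w j 0.
  by rewrite !mxE subr_ge0 -ler_pdivlMr // i_min.
have wi : w i 0 = 0 by rewrite !mxE /c divfK ?subrr // gt_eqF.
have Aw : A *m w = theta *: w.
  by rewrite mulmxBr -scalemxAr AV Av scalerBr !scalerA mulrC.
have Alw l : A ^+ l *m w = theta ^+ l *: w.
  elim: l => [|l IH]; first by rewrite !expr0 mul1mx scale1r.
  by rewrite exprSr -mulmxE -mulmxA Aw -scalemxAr IH scalerA exprS.
have w0 j : w j 0 = 0.
  have [l _ Aij] := A_irr i j; apply/eqP; rewrite eq_le w_ge0 andbT.
  have := congr1 (fun M : 'cV[R]_n => M i 0) (Alw l).
  rewrite mxE [in RHS]mxE wi mulr0 => s0.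
  rewrite -(pmulr_rle0 _ Aij) -s0 (bigD1 j) //= lerDl sumr_ge0 // => k _.
  by rewrite mulr_ge0 // expmx_ge0.
apply/eqP; rewrite -subr_eq0; apply/eqP/matrixP => j k.
by rewrite ord1 [RHS]mxE; exact: w0.
Qed.

Let P : 'M[R]_n := V *m U^T.
Let B : 'M[R]_n := A - theta *: P.

Let PP : P *m P = P.
Proof. by rewrite /P -mulmxA [U^T *m _]mulmxA UV mul1mx. Qed.

Let PB : P *m B = 0.
Proof.
by rewrite mulmxBr -scalemxAr PP /P -mulmxA UA -scalemxAr subrr.
Qed.

(** Deflation: [B] kills [V], and agrees with [A] on the kernel of [U^T], which
    contains the eigenvectors of [B] for [theta].  Such an eigenvector is one of
    [A], hence a multiple of [V], and [U^T *m V] is not zero. *)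
Lemma deflated_unit : theta%:M - B \in unitmx.
Proof.
rewrite -unitmx_tr -row_free_unit; apply: inj_row_free => v vB.
have {vB} : (theta%:M - B) *m v^T = 0.
  by apply: trmx_inj; rewrite trmx_mul trmxK vB trmx0.
have t0 : theta != 0 by rewrite gt_eqF.
rewrite mulmxBl mul_scalar_mx => /eqP; rewrite subr_eq0 => /eqP vB.
have UvT : U^T *m v^T = 0.
  have : P *m (theta *: v^T) = 0 by rewrite vB mulmxA PB mul0mx.
  rewrite -scalemxAr => /eqP; rewrite scaler_eq0 (negbTE t0) /= => /eqP Pv.
  by rewrite -[U^T]mul1mx -UV -2!mulmxA [V *m _]mulmxA -/P Pv mulmx0.
have : A *m v^T = theta *: v^T.
  by rewrite vB mulmxBl -scalemxAl /P -[V *m _ *m _]mulmxA UvT mulmx0 scaler0 subr0.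
move=> /eigenvector_unique[c vE].
move: UvT; rewrite vE -scalemxAr UV => /matrixP/(_ 0 0).
rewrite !mxE eqxx mulr1 => c0; apply: trmx_inj.
by rewrite vE c0 scale0r trmx0.
Qed.

(** [P] commutes with [A]; on its kernel the resolvent of [A] is that of [B],
    regular at [theta], and on its image it is [(z - theta)^-1]. *)
Lemma resolventE z : z != 0 -> z != theta -> z%:M - B \in unitmx ->
  z%:M - A \in unitmx /\
  invmx (z%:M - A) = invmx (z%:M - B) *m (1%:M - P) + (z - theta)^-1 *: P.
Proof.
move=> z0 zt Bu; set X := invmx _ *m _ + _.
suff XA : (z%:M - A) *m X = 1%:M.
  have [Au _] := mulmx1_unit XA; split=> //.
  by rewrite -[RHS]mul1mx -(mulVmx Au) -mulmxA XA mulmx1.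
have P1 : P *m (1%:M - P) = 0 by rewrite mulmxBr mulmx1 PP subrr.
have PBz : P *m (z%:M - B) = z *: P by rewrite mulmxBr PB subr0 mul_mx_scalar.
have PX : P *m (invmx (z%:M - B) *m (1%:M - P)) = 0.
  apply: (scalerI z0); rewrite scaler0 scalemxAl -PBz -mulmxA.
  by rewrite [(z%:M - B) *m _]mulmxA mulmxV // mul1mx.
have AE : z%:M - A = (z%:M - B) - theta *: P.
  by rewrite /B opprB addrA addrAC addrK.
have AP : (z%:M - A) *m P = (z - theta) *: P.
  by rewrite mulmxBl mul_scalar_mx /P mulmxA AV -scalemxAl scalerBl.
rewrite /X mulmxDr -scalemxAr AP scalerA mulVf ?subr_eq0 // scale1r.
rewrite AE mulmxBl -scalemxAl PX scaler0 subr0 mulmxA mulmxV // mul1mx.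
by rewrite subrK.
Qed.

Let evalB z : z%:M - B = map_mx (horner_eval z) (char_poly_mx B).
Proof.
by apply/matrixP => i j; rewrite !mxE /horner_eval !hornerE hornerMn hornerX.
Qed.

Let deflated_unit_near : \forall z \near theta^',
  [/\ z != 0, z != theta & z%:M - B \in unitmx].
Proof.
have unitE z : (z%:M - B \in unitmx) = ((char_poly B).[z] != 0).
  by rewrite evalB unitmxE (det_map_mx (horner_eval z)) unitfE.
have d0 : (char_poly B).[theta] != 0 by rewrite -unitE deflated_unit.
have t0 : theta != 0 by rewrite gt_eqF.
near=> z; rewrite unitE; split; near: z.
- by apply: nbhs_dnbhs; exact: (cvgr_neq0 _ cvg_id t0).
- exact: nbhs_dnbhs_neq.
- by apply: nbhs_dnbhs; exact: poly_neq0_nbhs.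
Unshelve. all: by end_near. Qed.

Lemma resolvent_unit_near : \forall z \near theta^', z%:M - A \in unitmx.
Proof.
by apply: filterS deflated_unit_near => z [z0 zt /(resolventE z0 zt)[]].
Qed.

Lemma cvg_resolvent i j :
  (z - theta) * invmx (z%:M - A) i j @[z --> theta^'] --> V i 0 * U j 0.
Proof.
pose g z := (z - theta) * \sum_k invmx (z%:M - B) i k * (1%:M - P) k j + P i j.
have gc : g z @[z --> theta] --> V i 0 * U j 0.
  have PE : V i 0 * U j 0 = P i j by rewrite !mxE big_ord1 mxE.
  rewrite PE -[X in _ --> X]add0r.
  rewrite -[X in X + _](mul0r (\sum_k invmx (theta%:M - B) i k * (1%:M - P) k j)).
  rewrite -[X in X * _](subrr theta).
  apply: cvgD; last exact: cvg_cst.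
  apply: cvgM; first by apply: cvgB; [exact: cvg_id|exact: cvg_cst].
  apply: cvg_sumr => k; apply: cvgM; last exact: cvg_cst.
  under eq_cvg do rewrite evalB; rewrite evalB.
  by apply: cvg_invmx; rewrite -evalB deflated_unit.
have gc' : g z @[z --> theta^'] --> V i 0 * U j 0.
  exact: cvg_trans (cvg_app _ (@nbhs_dnbhs _ theta)) gc.
apply: cvg_trans gc'; apply: near_eq_cvg.
apply: filterS deflated_unit_near => z [z0 zt Bu].
have [_ ->] := resolventE z0 zt Bu.
rewrite mxE [X in _ * (X + _)]mxE [X in _ * (_ + X)]mxE.
by rewrite mulrDr [in X in _ = _ + X]mulrA mulfV ?subr_eq0 // mul1r.
Qed.

End Resolvent.

(** * Row sums of the inverse correlation matrix at the Perron root *)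

Section RowSums.
Variables (R : realType) (q s m : nat) (a : s.-tuple (seq 'I_q)) (theta : R).
Hypothesis a_size : forall i, (1 < size (tnth a i))%N.
Hypothesis a_m : forall i, (size (tnth a i) <= m.+1)%N.
Hypothesis a_anti : forall i j, infix (tnth a i) (tnth a j) -> i = j.
Hypothesis theta_neq0 : theta != 0.
Variables (b : R -> seq 'I_q -> R) (c : seq 'I_q -> R) (kappa : R).
Hypothesis b_flow : \forall z \near theta^', forall x, size x = m ->
  avoids a x ->
  z * b z x = z ^- m + \sum_d (avoids a (d :: x))%:R * b z (take m (d :: x)).
Hypothesis b_cvg : forall x, size x = m -> avoids a x ->
  (z - theta) * b z x @[z --> theta^'] --> c x.
Hypothesis kappaE : \sum_(x <- words q m) (avoids a x)%:R * c x = kappa.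
Hypothesis kappa_neq0 : kappa != 0.

Let a_ne i : (0 < size (tnth a i))%N. Proof. exact: ltnW. Qed.

Let W z phi := weight a m z (b z) phi.

Let cvg_id' : (z : R) @[z --> theta^'] --> theta.
Proof. exact: cvg_trans (cvg_app _ (@nbhs_dnbhs _ theta)) cvg_id. Qed.

Let cvg_horner (p : {poly R}) : p.[z] @[z --> theta^'] --> p.[theta].
Proof.
exact: cvg_trans (cvg_app _ (@nbhs_dnbhs _ theta)) (@continuous_horner _ p theta).
Qed.

Let cvg_exp k : (z : R) ^+ k @[z --> theta^'] --> theta ^+ k.
Proof.
under eq_cvg do rewrite -hornerXn; rewrite -hornerXn; exact: cvg_horner.
Qed.

Let cvg_sub : (z : R) - theta @[z --> theta^'] --> 0.
Proof. by rewrite -(subrr theta); apply: cvgB => //; exact: cvg_cst. Qed.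

Let near_neq : \forall z \near theta^', z != theta.
Proof. exact: nbhs_dnbhs_neq. Qed.

Let near_neq0 : \forall z \near theta^', z != 0.
Proof. exact: (cvgr_neq0 _ cvg_id' theta_neq0). Qed.

(** Only the words of length [m] contribute to the residue of the weight. *)
Lemma cvg_weight phi : (z - theta) * W z phi @[z --> theta^'] -->
  \sum_(x <- words q m) (avoids a x)%:R * c x * phi x.
Proof.
have -> : (fun z => (z - theta) * W z phi) = (fun z =>
    \sum_(k < m) (z - theta) * (z ^- k.+1 *
      \sum_(u <- words q k) (avoids a u)%:R * phi u) +
    \sum_(x <- words q m | x \in words q m)
      (avoids a x)%:R * ((z - theta) * b z x) * phi x).
  apply/funext => z; rewrite /W /weight mulrDr; congr (_ + _).
    by rewrite mulr_sumr.
  by rewrite mulr_sumr big_seq; apply: eq_bigr => x _; ring.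
rewrite -[X in _ --> X]add0r; apply: cvgD.
  have s0 : 0 = \sum_(k < m) 0 :> R by rewrite big1.
  rewrite [X in _ --> X]s0.
  apply: cvg_sumr => k; rewrite -[X in _ --> X](mul0r (theta ^- k.+1 *
    \sum_(u <- words q k) (avoids a u)%:R * phi u)).
  apply: cvgM; first exact: cvg_sub.
  apply: cvgM; last exact: cvg_cst.
  by apply: cvgV; [rewrite expf_neq0|exact: cvg_exp].
rewrite big_seq.
have -> : (fun z : R => \sum_(x <- words q m | x \in words q m)
      (avoids a x)%:R * ((z - theta) * b z x) * phi x) =
    (fun z => \sum_(x <- words q m) if x \in words q m then
      (avoids a x)%:R * ((z - theta) * b z x) * phi x else 0).
  by apply/funext => z; rewrite big_mkcond.
rewrite big_mkcond; apply: cvg_sumr => x.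
case: ifP => [|_]; last exact: cvg_cst.
rewrite mem_words => /eqP xm; apply: cvgM; last exact: cvg_cst.
case avx: (avoids a x).
  by apply: cvgM; [exact: cvg_cst|exact: b_cvg].
under eq_cvg do rewrite mul0r; rewrite mul0r; exact: cvg_cst.
Qed.

Let cvg_weight1 : (z - theta) * W z (fun=> 1) @[z --> theta^'] --> kappa.
Proof.
have -> : kappa = \sum_(x <- words q m) (avoids a x)%:R * c x * 1.
  by rewrite -kappaE; apply: eq_bigr => x _; rewrite mulr1.
exact (@cvg_weight (fun=> 1)).
Qed.

Let weight1_neq0 : \forall z \near theta^', W z (fun=> 1) != 0.
Proof.
apply: filterS (cvgr_neq0 _ cvg_weight1 kappa_neq0) => z.
by rewrite mulf_eq0 negb_or => /andP[].
Qed.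

(** Where the correlation matrix is invertible, the row sums of its inverse are
    read off the solution of the linear system [weight_forbidden]. *)
Lemma inv_row_sum_near : \forall z \near theta^', forall i,
  inv_row_sum a i z = W z (ends R a i) / W z (fun=> 1).
Proof.
have Mu := correlation_mx_unit_near a_ne a_anti theta_neq0.
near=> z => i; have z0 : z != 0 by near: z.
have fl : forall x, size x = m -> avoids a x ->
  z * b z x = z ^- m + \sum_d (avoids a (d :: x))%:R * b z (take m (d :: x)).
  by near: z.
have Mz : correlation_mx a z \in unitmx by near: z.
have W0 : W z (fun=> 1) != 0 by near: z.
pose E : 'cV[R]_s := \col_j W z (ends R a j).
have ME : correlation_mx a z *m E = const_mx (W z (fun=> 1)).
  apply/matrixP => k l; rewrite !mxE /W -(weight_forbidden a_ne a_anti a_m z0 fl k).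
  by apply: eq_bigr => j _; rewrite correlation_mx_overlap // !mxE.
have : E = invmx (correlation_mx a z) *m const_mx (W z (fun=> 1)).
  by rewrite -ME mulKmx.
move=> /matrixP/(_ i 0); rewrite !mxE => ->.
rewrite /inv_row_sum; under [in RHS]eq_bigr do rewrite mxE.
by rewrite -mulr_suml mulfK.
Unshelve. all: by end_near. Qed.

Lemma inv_sum_near : \forall z \near theta^',
  inv_sum a z = (W z (fun=> 1))^-1 + q%:R - z.
Proof.
near=> z; have z0 : z != 0 by near: z.
have fl : forall x, size x = m -> avoids a x ->
  z * b z x = z ^- m + \sum_d (avoids a (d :: x))%:R * b z (take m (d :: x)).
  by near: z.
have W0 : W z (fun=> 1) != 0 by near: z.
have Ri : forall i, inv_row_sum a i z = W z (ends R a i) / W z (fun=> 1).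
  by near: z; exact: inv_row_sum_near.
rewrite /inv_sum; under eq_bigr => i _ do rewrite -/(inv_row_sum a i z) Ri.
rewrite -mulr_suml.
have := weight_letters a_ne a_anti z0 fl a_size; rewrite -/(W z _) => e.
have -> : \sum_i W z (ends R a i) = q%:R * W z (fun=> 1) - z * W z (fun=> 1) + 1.
  by rewrite e; ring.
by field.
Unshelve. all: by end_near. Qed.

Lemma cvg_inv_row_sum i : inv_row_sum a i z @[z --> theta^'] -->
  (\sum_(x <- words q m) (avoids a x)%:R * c x * ends R a i x) / kappa.
Proof.
have h : ((z - theta) * W z (ends R a i)) / ((z - theta) * W z (fun=> 1))
    @[z --> theta^'] -->
    (\sum_(x <- words q m) (avoids a x)%:R * c x * ends R a i x) / kappa.
  by apply: cvgM; [exact: cvg_weight|apply: cvgV].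
apply: cvg_trans h; apply: near_eq_cvg; near=> z.
have zt : z - theta != 0 by rewrite subr_eq0; near: z.
have -> : inv_row_sum a i z = W z (ends R a i) / W z (fun=> 1).
  by move: i; near: z; exact: inv_row_sum_near.
by rewrite -mulf_div mulfV // mul1r.
Unshelve. all: by end_near. Qed.

(** Before the limit, [weight_allowed] says that the left-hand side is the weight
    of the words ending with [x] relative to that of all words. *)
Lemma one_minus_row_sums x : size x = m -> avoids a x ->
  1 - \sum_i lim (inv_row_sum a i z @[z --> theta^'])
             * (overlap R (tnth a i) x).[theta] = theta ^+ m * c x / kappa.
Proof.
move=> xm avx; pose l i := lim (inv_row_sum a i z @[z --> theta^']).
have lP i : inv_row_sum a i z @[z --> theta^'] --> l i.
  exact: (cvgP _ (@cvg_inv_row_sum i)).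
have h1 : 1 - \sum_i inv_row_sum a i z * (overlap R (tnth a i) x).[z]
    @[z --> theta^'] --> 1 - \sum_i l i * (overlap R (tnth a i) x).[theta].
  apply: cvgB; first exact: cvg_cst.
  by apply: cvg_sumr => i; apply: cvgM.
have h2 : z ^+ m * ((z - theta) * b z x) / ((z - theta) * W z (fun=> 1))
    @[z --> theta^'] --> theta ^+ m * c x / kappa.
  by apply: cvgM; [apply: cvgM => //; exact: b_cvg|apply: cvgV].
have h3 : z ^+ m * ((z - theta) * b z x) / ((z - theta) * W z (fun=> 1))
    @[z --> theta^'] --> 1 - \sum_i l i * (overlap R (tnth a i) x).[theta].
  apply: cvg_trans h1; apply: near_eq_cvg; near=> z.
  have z0 : z != 0 by near: z.
  have fl : forall x, size x = m -> avoids a x ->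
    z * b z x = z ^- m + \sum_d (avoids a (d :: x))%:R * b z (take m (d :: x)).
    by near: z.
  have W0 : W z (fun=> 1) != 0 by near: z.
  have Ri : forall i, inv_row_sum a i z = W z (ends R a i) / W z (fun=> 1).
    by near: z; exact: inv_row_sum_near.
  have zt : z - theta != 0 by rewrite subr_eq0; near: z.
  rewrite mulrCA -mulf_div mulfV // mul1r.
  have e := weight_allowed a_ne a_anti a_m z0 fl xm avx.
  rewrite -/(W z (fun=> 1)) in e.
  have e' : W z (fun=> 1) - z ^+ m * b z x =
      \sum_i (overlap R (tnth a i) x).[z] * W z (ends R a i).
    by rewrite -e [X in X - _]addrC addrK.
  have -> : \sum_i inv_row_sum a i z * (overlap R (tnth a i) x).[z] =
      (W z (fun=> 1) - z ^+ m * b z x) / W z (fun=> 1).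
    rewrite e' mulr_suml; apply: eq_bigr => i _.
    by rewrite Ri mulrAC [X in X / _]mulrC.
  by field.
by rewrite -(cvg_lim _ h3) // (cvg_lim _ h2).
Unshelve. all: by end_near. Qed.

Lemma cvg_inv_sum : inv_sum a z @[z --> theta^'] --> q%:R - theta.
Proof.
have h : (z - theta) / ((z - theta) * W z (fun=> 1)) + q%:R - z
    @[z --> theta^'] --> q%:R - theta.
  rewrite -[q%:R in X in _ --> X]add0r -[0 in X in _ --> X](mul0r kappa^-1).
  apply: cvgB => //; apply: cvgD; last exact: cvg_cst.
  by apply: cvgM => //; apply: cvgV.
apply: cvg_trans h; apply: near_eq_cvg; near=> z.
have zt : z - theta != 0 by rewrite subr_eq0; near: z.
have -> : inv_sum a z = (W z (fun=> 1))^-1 + q%:R - z.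
  by near: z; exact: inv_sum_near.
have W0 : W z (fun=> 1) != 0 by near: z.
by rewrite invfM mulVKf.
Unshelve. all: by end_near. Qed.

(** Off [theta] the function [inv_sum a] is continuous wherever the correlation
    matrix is invertible. *)
Lemma regularize_near : \forall z \near theta^',
  regularize (inv_sum a) z = inv_sum a z.
Proof.
apply: filterS (correlation_mx_unit_near a_ne a_anti theta_neq0) => z Mu.
apply: cvg_lim => //; apply: cvg_trans (cvg_app _ (@nbhs_dnbhs _ z)) _.
apply: cvg_sumr => i; apply: cvg_sumr => j.
under eq_cvg do rewrite correlation_mx_eval; rewrite correlation_mx_eval.
by apply: cvg_invmx; rewrite -correlation_mx_eval.
Qed.

(** Near [theta] one has [r z = q - z + (z - theta) / K z], where
    [K z = (z - theta) * W z (fun=> 1)] tends to [kappa]. *)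
Lemma is_derive_inv_sum :
  is_derive theta (1 : R) (regularize (inv_sum a)) (kappa^-1 - 1).
Proof.
set g := regularize _.
have g0 : g theta = q%:R - theta by apply: cvg_lim => //; exact: cvg_inv_sum.
have gc : (z - theta)^-1 * (g z - g theta) @[z --> theta^'] --> kappa^-1 - 1.
  have h : ((z - theta) * W z (fun=> 1))^-1 - 1 @[z --> theta^'] -->
      kappa^-1 - 1.
    by apply: cvgB; [apply: cvgV|exact: cvg_cst].
  apply: cvg_trans h; apply: near_eq_cvg; near=> z.
  have zt : z - theta != 0 by rewrite subr_eq0; near: z.
  have W0 : W z (fun=> 1) != 0 by near: z.
  rewrite g0 (_ : g z = (W z (fun=> 1))^-1 + q%:R - z).
    by field; rewrite zt W0.
  rewrite (_ : g z = inv_sum a z); last by near: z; exact: regularize_near.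
  by near: z; exact: inv_sum_near.
have sc : h + theta @[h --> (0 : R)^'] --> theta^'.
  rewrite -[X in _ --> X^']add0r.
  apply: (@continuous_injective_withinNx R R (fun h => h + theta)).
    by apply: cvgD; [exact: cvg_id|exact: cvg_cst].
  by move=> h /addIr.
have dc : h^-1 *: ((g \o shift theta) (h *: (1 : R)) - g theta)
    @[h --> (0 : R)^'] --> kappa^-1 - 1.
  have := cvg_comp _ _ sc gc; apply: cvg_trans; apply: near_eq_cvg.
  by apply: nearW => h /=; rewrite addrK [h *: _]mulr1.
by apply: DeriveDef; [exact: cvgP dc|exact: (cvg_lim _ dc)].
Unshelve. all: by end_near. Qed.

End RowSums.

(** * The flow equations on the adjacency graph *)

Section Graph.
Variables (R : realType) (q : nat) (F : seq (seq 'I_q)) (m : nat).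
(* The states are words of length [m.+1]; a transition keeps [m] letters. *)
Hypothesis F_max : maxlen F = m.+2.
Hypothesis allowedE : forall u, allowed F u <-> avoids F u.
Implicit Types (u v x y : seq 'I_q).

Local Notation N := (size (states F)).
Local Notation A := (adjacency R F).

Lemma mem_states u : (u \in states F) = (size u == m.+1) && avoids F u.
Proof.
rewrite mem_filter mem_words F_max andbC; congr (_ && _).
by apply/asboolP/idP => /allowedE.
Qed.

Lemma state_uniq : injective (@state q F).
Proof.
move=> i j /eqP; rewrite nth_uniq ?ltn_ord ?filter_uniq ?words_uniq //.
by move/eqP => ij; apply: val_inj.
Qed.

Lemma size_state i : size (@state q F i) = m.+1.
Proof. by have := mem_nth [::] (ltn_ord i); rewrite mem_states => /andP[/eqP]. Qed.

Lemma stateP x : size x = m.+1 -> avoids F x -> exists i, @state q F i = x.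
Proof.
move=> xm avx; have : x \in states F by rewrite mem_states xm eqxx.
by move=> /(nthP [::])[i iN <-]; exists (Ordinal iN).
Qed.

Lemma sum_states (f : seq 'I_q -> R) :
  \sum_i f (@state q F i) = \sum_(u <- words q m.+1) (avoids F u)%:R * f u.
Proof.
transitivity (\sum_(u <- states F) f u); first by rewrite (big_nth [::]) big_mkord.
rewrite big_filter F_max big_mkcond; apply: eq_bigr => u _.
have -> : `[< allowed F u >] = avoids F u by apply/asboolP/idP => /allowedE.
by case: (avoids F u); rewrite ?mul1r ?mul0r.
Qed.

(** Extending vectors indexed by the states to functions of words translates
    between the adjacency matrix and the transitions of one-letter extensions. *)
Definition on_words (rho : 'I_N -> R) x : R :=
  \sum_i (@state q F i == x)%:R * rho i.

Lemma on_words_state rho i : on_words rho (@state q F i) = rho i.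
Proof.
rewrite /on_words (bigD1 i) //= eqxx mul1r big1 ?addr0 // => j ji.
case: eqP => [/state_uniq ij|_]; last by rewrite mul0r.
by rewrite ij eqxx in ji.
Qed.

Lemma adjacencyE i j : A i j =
  ((drop 1 (@state q F i) == take m (@state q F j)) &&
   avoids F (@state q F i ++ drop m (@state q F j)))%:R.
Proof.
rewrite mxE F_max !subSS subn0; congr ((nat_of_bool (_ && _))%:R).
by apply/asboolP/idP => /allowedE.
Qed.

Lemma sum_predecessors rho j :
  \sum_i rho i * A i j = \sum_d (avoids F (d :: @state q F j))%:R
    * on_words rho (take m.+1 (d :: @state q F j)).
Proof.
set x := @state q F j; have xm : size x = m.+1 := size_state j.
transitivity (\sum_i on_words rho (@state q F i) *
   ((drop 1 (@state q F i) == take m x) &&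
     avoids F (@state q F i ++ drop m x))%:R).
  by apply: eq_bigr => i _; rewrite on_words_state adjacencyE.
rewrite (sum_states (fun u => on_words rho u *
   ((drop 1 u == take m x) && avoids F (u ++ drop m x))%:R)).
rewrite big_words_cons; apply: eq_bigr => d _.
have sx : size (take m x) = m by rewrite size_takel // xm.
rewrite (big_words_eq sx) => [|u um ux] /=; last first.
  by rewrite drop0 (negbTE ux) !mulr0.
rewrite drop0 eqxx /= cat_take_drop; case dx: (avoids F (d :: x)).
  rewrite (_ : avoids F _); first by rewrite mulr1.
  apply: avoids_infix dx; rewrite -[d :: x]/([:: d] ++ x).
  by rewrite -{2}(cat_take_drop m x) catA prefix_infix.
by rewrite !mulr0 mul0r.
Qed.

Lemma sum_successors tau i :
  \sum_j A i j * tau j = \sum_d (avoids F (rcons (@state q F i) d))%:R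
    * on_words tau (behead (rcons (@state q F i) d)).
Proof.
set y := @state q F i; have ym : size y = m.+1 := size_state i.
have bh d : behead (rcons y d) = rcons (behead y) d by case: (y) ym.
transitivity (\sum_j ((drop 1 y == take m (@state q F j)) &&
     avoids F (y ++ drop m (@state q F j)))%:R * on_words tau (@state q F j)).
  by apply: eq_bigr => j _; rewrite on_words_state adjacencyE.
rewrite (sum_states (fun u =>
   ((drop 1 y == take m u) && avoids F (y ++ drop m u))%:R * on_words tau u)).
rewrite big_words_rcons exchange_big; apply: eq_bigr => d _.
have sy : size (drop 1 y) = m by rewrite size_drop ym subn1.
rewrite (big_words_eq sy) => [|u um uy] /=; last first.
  by rewrite -cats1 take_size_cat // eq_sym (negbTE uy) mul0r mulr0.
rewrite -!cats1 take_size_cat // drop_size_cat // eqxx /= drop1 !cats1.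
rewrite -bh; case yd: (avoids F (rcons y d)).
  have bd : avoids F (behead (rcons y d)).
    by rewrite -drop1; apply: avoids_infix yd; exact: infix_drop.
  by rewrite bd !mul1r.
by rewrite !mul0r mulr0.
Qed.

(** As [(z - A)^-1] is the sum of the [z ^- k.+1 * A ^+ k] for large [z], its
    column sums are the weights of the words with a given last state, and its
    row sums those of the words with a given first state.  The factor accounts
    for the letters of the initial state. *)
Definition left_weight z x : R :=
  z ^- m.+1 * on_words (fun j => \sum_i invmx (z%:M - A) i j) x.

Definition right_weight z x : R :=
  z ^- m.+1 * on_words (fun i => \sum_j invmx (z%:M - A) i j) x.

Lemma left_weight_flow z x : z%:M - A \in unitmx ->
  size x = m.+1 -> avoids F x -> z * left_weight z x =
  z ^- m.+1 + \sum_d (avoids F (d :: x))%:R * left_weight z (take m.+1 (d :: x)).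
Proof.
move=> zA xm avx; have [j <-] := stateP xm avx.
set rho := fun j => \sum_i invmx (z%:M - A) i j.
have -> : \sum_d (avoids F (d :: @state q F j))%:R *
    left_weight z (take m.+1 (d :: @state q F j)) =
    z ^- m.+1 * \sum_i rho i * A i j.
  rewrite sum_predecessors mulr_sumr.
  by apply: eq_bigr => d _; rewrite mulrCA.
rewrite /left_weight on_words_state -/rho mulrCA -{2}[z ^- m.+1]mulr1 -mulrDr.
congr (_ * _); apply/eqP; rewrite -subr_eq; apply/eqP.
have : (\row_j rho j) *m (z%:M - A) = const_mx 1.
  rewrite (_ : \row_j rho j = const_mx 1 *m invmx (z%:M - A)); last first.
    by apply/rowP => k; rewrite !mxE; apply: eq_bigr => i _; rewrite mxE mul1r.
  by rewrite mulmxKV.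
move=> /matrixP/(_ 0 j); rewrite mulmxBr mul_mx_scalar !mxE; apply: etrans.
by congr (_ - _); apply: eq_bigr => i _; rewrite !mxE.
Qed.

Lemma right_weight_flow z y : z%:M - A \in unitmx ->
  size y = m.+1 -> avoids F y -> z * right_weight z y =
  z ^- m.+1 + \sum_d (avoids F (rcons y d))%:R
                     * right_weight z (behead (rcons y d)).
Proof.
move=> zA ym avy; have [i <-] := stateP ym avy.
set tau := fun i => \sum_j invmx (z%:M - A) i j.
have -> : \sum_d (avoids F (rcons (@state q F i) d))%:R *
    right_weight z (behead (rcons (@state q F i) d)) =
    z ^- m.+1 * \sum_j A i j * tau j.
  rewrite sum_successors mulr_sumr.
  by apply: eq_bigr => d _; rewrite mulrCA.
rewrite /right_weight on_words_state -/tau mulrCA -{2}[z ^- m.+1]mulr1 -mulrDr.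
congr (_ * _); apply/eqP; rewrite -subr_eq; apply/eqP.
have : (z%:M - A) *m (\col_i tau i) = const_mx 1.
  rewrite (_ : \col_i tau i = invmx (z%:M - A) *m const_mx 1); last first.
    by apply/colP => k; rewrite !mxE; apply: eq_bigr => j _; rewrite mxE mulr1.
  by rewrite mulKVmx.
move=> /matrixP/(_ i 0); rewrite mulmxBl mul_scalar_mx !mxE; apply: etrans.
by congr (_ - _); apply: eq_bigr => j _; rewrite !mxE.
Qed.

End Graph.

(** * The Parry measure of a cylinder *)

Section Residues.
Variables (R : realType) (q : nat) (F : seq (seq 'I_q)) (m : nat) (theta : R).
Variables (U V : 'cV[R]_(size (states F))).
Hypothesis F_max : maxlen F = m.+2.
Hypothesis allowedE : forall u, allowed F u <-> avoids F u.
Hypothesis theta_gt0 : 0 < theta.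
Hypothesis A_irr : irreducible_mx (adjacency R F).
Hypothesis V_gt0 : forall i, 0 < V i 0.
Hypothesis AV : adjacency R F *m V = theta *: V.
Hypothesis UA : U^T *m adjacency R F = theta *: U^T.
Hypothesis UV : U^T *m V = 1%:M.

Let A_ge0 i j : 0 <= adjacency R F i j. Proof. by rewrite mxE ler0n. Qed.

Let cvg_expV : (z : R) ^- m.+1 @[z --> theta^'] --> theta ^- m.+1.
Proof.
apply: cvgV; first by rewrite expf_neq0 // gt_eqF.
under eq_cvg do rewrite -hornerXn; rewrite -hornerXn.
exact: cvg_trans (cvg_app _ (@nbhs_dnbhs _ theta)) (@continuous_horner _ _ theta).
Qed.

Lemma cvg_left_weight x : size x = m.+1 -> avoids F x ->
  (z - theta) * left_weight F m z x @[z --> theta^'] -->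
  theta ^- m.+1 * (\sum_i V i 0) * on_words (fun j => U j 0) x.
Proof.
move=> xm avx; have [j <-] := stateP F_max allowedE xm avx.
rewrite on_words_state -mulrA mulr_suml.
have -> : (fun z => (z - theta) * left_weight F m z (@state q F j)) = (fun z =>
    z ^- m.+1 * \sum_i ((z - theta) * invmx (z%:M - adjacency R F) i j)).
  by apply/funext => z; rewrite /left_weight on_words_state mulrCA mulr_sumr.
apply: cvgM; first exact: cvg_expV.
by apply: cvg_sumr => i; exact: cvg_resolvent.
Qed.

Lemma cvg_right_weight y : size y = m.+1 -> avoids F y ->
  (z - theta) * right_weight F m z y @[z --> theta^'] -->
  theta ^- m.+1 * (\sum_j U j 0) * on_words (fun i => V i 0) y.
Proof.
move=> ym avy; have [i <-] := stateP F_max allowedE ym avy.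
rewrite on_words_state -mulrA mulr_suml.
have -> : (fun z => (z - theta) * right_weight F m z (@state q F i)) = (fun z =>
    z ^- m.+1 * \sum_j ((z - theta) * invmx (z%:M - adjacency R F) i j)).
  by apply/funext => z; rewrite /right_weight on_words_state mulrCA mulr_sumr.
apply: cvgM; first exact: cvg_expV.
by apply: cvg_sumr => j; rewrite mulrC; exact: cvg_resolvent.
Qed.

Lemma sum_on_words k (rho : 'I_(size (states F)) -> R) :
  \sum_(x <- words q m.+1) (avoids F x)%:R * (k * on_words rho x) =
  k * \sum_i rho i.
Proof.
rewrite -(sum_states F_max allowedE (fun x => k * on_words rho x)) mulr_sumr.
by apply: eq_bigr => i _; rewrite on_words_state.
Qed.

End Residues.

Unset Implicit Arguments.

Theorem theorem4 (R : realType) (q : nat) (hq : (2 <= q)%N)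
    (s : nat) (hs : (0 < s)%N) (a : s.-tuple (seq 'I_q))
    (a_uniq : uniq a)
    (a_size : forall i : 'I_s, (2 <= size (tnth a i))%N)
    (a_min : minimal_collection a)
    (p : nat) (hp : p = maxlen a)
    (a_irr : irreducible_mx (adjacency R a))
    (theta : R) (htheta : theta = perron_root R a)
    (theta_gt1 : 1 < theta)
    (x0 : subshift a)
    (mu : probability (g_sigma_algebraType (cylinders x0)) R)
    (mu_parry : is_parry_measure mu)
    (w x y : seq 'I_q) (n : nat)
    (w_allowed : allowed a w) (w_size : size w = n) (hn : (p <= n)%N)
    (x_size : size x = (p - 1)%N) (x_w : prefix x w)
    (y_size : size y = (p - 1)%N) (y_w : suffix y w) :
  [/\ forall i : 'I_s, cvg (inv_row_sum a i z @[z --> theta^']),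
      forall j : 'I_s, cvg (inv_col_sum a j z @[z --> theta^']),
      cvg (inv_sum a z @[z --> theta^']) /\
        derivable (regularize (inv_sum a)) theta 1,
      1 + derive1 (regularize (inv_sum a)) theta != 0
    & mu (cylinder x0 w) =
      ((1 - \sum_(i < s) lim (inv_row_sum a i z @[z --> theta^'])
                         * (correlation R (behead (tnth a i)) x).[theta])
       * (1 - \sum_(j < s) lim (inv_col_sum a j z @[z --> theta^'])
                           * (correlation R y (tnth a j)).[theta])
       / (theta ^+ n * (1 + derive1 (regularize (inv_sum a)) theta)))%:E].
Proof.
have theta_gt0 : 0 < theta by rewrite (lt_trans ltr01).
have theta0 : theta != 0 by rewrite gt_eqF.
have allowedE u : allowed a u <-> avoids a u.
  split; first exact: allowed_avoids.
  apply: avoids_allowed => //; exists (tnth a (Ordinal hs)); first exact: mem_tnth.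
  by rewrite ltnW.
have a_le i : (size (tnth a i) <= maxlen a)%N.
  by rewrite /maxlen (big_rem (tnth a i)) ?mem_tnth //= leq_maxl.
have [m a_max] : exists m, maxlen a = m.+2.
  have := leq_trans (a_size (Ordinal hs)) (a_le (Ordinal hs)).
  by case: (maxlen a) => [|[|m]] // _; exists m.
have a_m i : (size (tnth a i) <= m.+2)%N by rewrite -a_max.
have a_anti i j : infix (tnth a i) (tnth a j) -> i = j.
  move=> ij; apply/eqP/negPn/negP => nij.
  have /allowedE : allowed a (tnth a i).
    apply: (a_min (tnth a j)) => //; first exact: mem_tnth.
    by apply: contra nij => /eqP e; rewrite -(inj_eq (tuple_uniqP _ a_uniq)) e.
  by rewrite (@avoids_infixN _ _ a i) // infix_refl.
have a_ne i : (0 < size (tnth a i))%N by exact: ltnW.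
move: hp x_size y_size hn; rewrite a_max => -> /= x_size y_size hn.
rewrite subn1 /= in x_size y_size.
case: mu_parry => U [V [[U_gt0 V_gt0] AV UA UV muE]].
rewrite -htheta in AV UA muE.
have avw : avoids a w by apply/allowedE.
have avx : avoids a x by apply: avoids_infix avw; exact: prefixW.
have avy : avoids a y by apply: avoids_infix avw; exact: suffixW.
have [i xE] := stateP a_max allowedE x_size avx.
have [j yE] := stateP a_max allowedE y_size avy.
pose SU := \sum_i U i 0; pose SV := \sum_i V i 0.
have SU0 : SU != 0.
  by rewrite gt_eqF // /SU (bigD1 i) //= ltr_pwDl // sumr_ge0 // => k _; rewrite ltW.
have SV0 : SV != 0.
  by rewrite gt_eqF // /SV (bigD1 i) //= ltr_pwDl // sumr_ge0 // => k _; rewrite ltW.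
have A_ge0 k l : 0 <= adjacency R a k l by rewrite mxE ler0n.
have zA := resolvent_unit_near A_ge0 a_irr theta_gt0 V_gt0 AV UA UV.
pose kappa := theta ^- m.+1 * SV * SU.
have kappa0 : kappa != 0 by rewrite !mulf_neq0 // invr_neq0 // expf_neq0.
(* Words read forward: the last states carry the left eigenvector. *)
pose c u := theta ^- m.+1 * SV * on_words (fun j => U j 0) u.
have flow : \forall z \near theta^', forall u, size u = m.+1 -> avoids a u ->
    z * left_weight a m z u = z ^- m.+1 +
      \sum_d (avoids a (d :: u))%:R * left_weight a m z (take m.+1 (d :: u)).
  by apply: filterS zA => z zA u; exact: left_weight_flow.
have lim_c u : size u = m.+1 -> avoids a u ->
    (z - theta) * left_weight a m z u @[z --> theta^'] --> c u.
  by move=> um avu; apply: cvg_left_weight.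
have sum_c : \sum_(u <- words q m.+1) (avoids a u)%:R * c u = kappa.
  exact: sum_on_words.
have row_cvg := cvg_inv_row_sum a_size a_m a_anti theta0 flow lim_c sum_c kappa0.
have row_sums := one_minus_row_sums a_size a_m a_anti theta0 flow lim_c sum_c
  kappa0 x_size avx.
have sum_cvg := cvg_inv_sum a_size a_m a_anti theta0 flow lim_c sum_c kappa0.
have sum_der := is_derive_inv_sum a_size a_m a_anti theta0 flow lim_c sum_c kappa0.
(* Words read backward: reversal transposes the correlation matrix, and the
   first states carry the right eigenvector. *)
pose a' := map_tuple rev a.
have a'E k : tnth a' k = rev (tnth a k) by rewrite tnth_map.
have a'_size k : (1 < size (tnth a' k))%N by rewrite a'E size_rev.
have a'_m k : (size (tnth a' k) <= m.+2)%N by rewrite a'E size_rev.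
have a'_anti k l : infix (tnth a' k) (tnth a' l) -> k = l.
  by rewrite !a'E infix_rev; exact: a_anti.
have av' u : avoids a' u = avoids a (rev u).
  by rewrite -{1}[u]revK avoids_rev.
pose b' (z : R) u := right_weight a m z (rev u).
pose c' u := theta ^- m.+1 * SU * on_words (fun i => V i 0) (rev u).
have flow' : \forall z \near theta^', forall u, size u = m.+1 -> avoids a' u ->
    z * b' z u = z ^- m.+1 +
      \sum_d (avoids a' (d :: u))%:R * b' z (take m.+1 (d :: u)).
  apply: filterS zA => z zA u um; rewrite av' => avu.
  have ru : size (rev u) = m.+1 by rewrite size_rev.
  rewrite /b' (right_weight_flow a_max allowedE zA ru avu); congr (_ + _).
  apply: eq_bigr => d _; rewrite av' rev_cons; congr (_ * right_weight _ _ _ _).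
  by rewrite -drop1 -rev_cons drop_rev /= um subn1.
have lim_c' u : size u = m.+1 -> avoids a' u ->
    (z - theta) * b' z u @[z --> theta^'] --> c' u.
  by rewrite av' => um avu; apply: cvg_right_weight; rewrite ?size_rev.
have sum_c' : \sum_(u <- words q m.+1) (avoids a' u)%:R * c' u = kappa.
  rewrite /kappa mulrAC -(sum_on_words a_max allowedE) -[RHS]big_words_rev.
  by apply: eq_bigr => u _; rewrite av'.
have corr' (z : R) : correlation_mx a' z = (correlation_mx a z)^T.
  apply/matrixP => k l; rewrite [RHS]mxE !correlation_mx_overlap //.
  by rewrite !a'E overlap_rev.
have col_row k (z : R) : inv_row_sum a' k z = inv_col_sum a k z.
  rewrite /inv_row_sum /inv_col_sum corr' -trmx_inv.
  by apply: eq_bigr => l _; rewrite mxE.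
have col_rowE k : @inv_row_sum R _ _ a' k = inv_col_sum a k.
  by apply/funext => z; exact: col_row.
have col_cvg := cvg_inv_row_sum a'_size a'_m a'_anti theta0 flow' lim_c' sum_c' kappa0.
have avy' : avoids a' (rev y) by rewrite av' revK.
have y'_size : size (rev y) = m.+1 by rewrite size_rev.
have col_sums := one_minus_row_sums a'_size a'_m a'_anti theta0 flow' lim_c' sum_c'
  kappa0 y'_size avy'.
have derE : derive1 (regularize (inv_sum a)) theta = kappa^-1 - 1.
  by rewrite derive1E; exact: derive_val.
have der1 : 1 + derive1 (regularize (inv_sum a)) theta = kappa^-1.
  by rewrite derE addrC subrK.
split.
- by move=> k; exact: cvgP (row_cvg k).
- by move=> k; rewrite -col_rowE; exact: cvgP (col_cvg k).
- by split; [exact: cvgP sum_cvg|exact: ex_derive].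
- by rewrite der1 invr_neq0.
rewrite (muE w i j) ?w_size ?a_max //; [|by rewrite xE|by rewrite yE].
congr (_%:E).
have -> : \sum_(k < s) lim (inv_row_sum a k z @[z --> theta^'])
      * (correlation R (behead (tnth a k)) x).[theta] =
    \sum_k lim (inv_row_sum a k z @[z --> theta^'])
      * (overlap R (tnth a k) x).[theta].
  apply: eq_bigr => k _; rewrite correlation_overlap => [|xk].
    rewrite overlap_behead //; apply: contraL avx => kx.
    by rewrite (@avoids_infixN _ _ a k) //; exact: prefixW.
  by apply: infix_eq_size xk _; rewrite size_behead x_size -ltnS prednK.
have -> : \sum_(k < s) lim (inv_col_sum a k z @[z --> theta^'])
      * (correlation R y (tnth a k)).[theta] =
    \sum_k lim (inv_row_sum a' k z @[z --> theta^'])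
      * (overlap R (tnth a' k) (rev y)).[theta].
  apply: eq_bigr => k _; rewrite col_rowE a'E overlap_rev correlation_overlap //.
  by move=> ky; rewrite (@avoids_infixN _ _ a k) in avy.
rewrite row_sums col_sums der1 /c /c' revK -xE -yE !on_words_state //.
have -> : (n - m.+2 + 1 = n - m.+1)%N by lia.
rewrite -[in RHS](@subnK m.+1 n) 1?ltnW // exprD /kappa.
have tk k : theta ^+ k != 0 by rewrite expf_neq0.
by field; rewrite !tk SU0 SV0.
Qed.
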